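(* Every domain $D\subset\mathbb{R}^n$ has a norming function.
   Context: A domain is a nonempty connected open set. For a positive continuous function $\phi$ on a domain $D\subset\mathbb{R}^n$ and a Lebesgue measurable function $u$ on $D$, put $\|u\|_\phi=\int_D|u|\,\phi\,dx$; more generally, for a measurable set $E\subset D$, put $\|u\|_{L^1(E,\phi)}=\int_E|u|\,\phi\,dx$. ''Negative'' means $\le 0$, and negative subharmonic functions are assumed not to be identically $-\infty$. The notation $A\Subset D$ means that $A$ is relatively compact in $D$. A positive continuous function $\phi$ on $D$ is called norming if for each compact set $F\subset D$ there is a constant $C(F)>0$, and for every increasing sequence of subdomains $D_j\Subset D$ with $\bigcup_j D_j=D$ there is a sequence of numbers $\varepsilon_j>0$ converging to $0$, such that for every negative subharmonic function $u$ on $D$: (1) $\|u\|_\phi<\infty$; (2) $u(x)\le -C(F)\|u\|_\phi$ for every $x\in F$; (3) $\|u\|_{L^1(D\setminus D_j,\phi)}\le\varepsilon_j\|u\|_\phi$ for every $j$. (The constants $C(F)$ and $\varepsilon_j$ do not depend on $u$.) *)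

(* Defs.v *)
From HB Require Import structures.
From mathcomp Require Import all_boot all_order all_algebra.
From mathcomp Require Import all_classical all_reals all_analysis.
From mathcomp Require Import measurable_realfun.

Set Implicit Arguments.
Unset Strict Implicit.
Unset Printing Implicit Defensive.
Import Order.TTheory GRing.Theory Num.Theory.
Import numFieldNormedType.Exports.
Local Open Scope classical_set_scope.
Local Open Scope ring_scope.

(* R^n is 'rV[R]_n with its library (product) topology, equipped with the
   Borel sigma-algebra. *)
HB.instance Definition _ (R : realType) (n : nat) :=
  @isMeasurable.Build (sigma_display (@open 'rV[R]_n)) 'rV[R]_n
    <<s @open 'rV[R]_n >> (@sigma_algebra0 _ setT _)
    (@sigma_algebraC 'rV[R]_n _) (@sigma_algebra_bigcup _ setT _).

Section Lebesgue_rV.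
Context {R : realType}.
Local Notation RM := (measurableTypeR R).

Lemma open_measurable_rV n (U : set 'rV[R]_n) : open U -> measurable U.
Proof. exact: sub_sigma_algebra. Qed.

Lemma measurable_coord_rV n (i : 'I_n) :
  measurable_fun [set: 'rV[R]_n] (fun x : 'rV[R]_n => x 0 i : RM).
Proof.
apply: (measurability _ (RGenOpens.measurableE R)) => _ [_ [a [b ->]] <-].
rewrite setTI; apply: open_measurable_rV.
apply: (open_comp _ (interval_open _ _)) => //.
by move=> x _; exact: coord_continuous.
Qed.

Definition box_rV n (A : 'I_n -> set R) : set 'rV[R]_n :=
  [set x | forall i, A i (x 0 i)].

Lemma measurable_box_rV n (A : 'I_n -> set RM) :
  (forall i, measurable (A i)) -> measurable (box_rV A).
Proof.
move=> mA.
have -> : box_rV A =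
    \bigcap_(i in [set: 'I_n]) ((fun x : 'rV[R]_n => x 0 i : RM) @^-1` A i).
  by apply/seteqP; split=> [x Ax i _|x Ax i]; [exact: Ax|exact: (Ax i)].
apply: fin_bigcap_measurable => // i _.
by rewrite -[X in measurable X]setTI; exact: measurable_coord_rV.
Qed.

Lemma open_bigcup_ball_rV n (U : set 'rV[R]_n) : open U ->
  U = \bigcup_(qk in [set qk : 'rV[rat]_n * nat |
         ball (map_mx ratr qk.1 : 'rV[R]_n) (qk.2.+1%:R^-1) `<=` U])
       ball (map_mx ratr qk.1 : 'rV[R]_n) (qk.2.+1%:R^-1).
Proof.
move=> oU; apply/seteqP; split=> [x Ux|x [qk /= qkU]]; last exact: qkU.
have /nbhs_ballP[e /= e0 xeU] : nbhs x U by exact: open_nbhs_nbhs.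
have [k ke] : exists k : nat, k.+1%:R^-1 < e / 2 :> R.
  have := @cvg_harmonic R => /cvgrPdist_lt/(_ (e / 2)).
  rewrite divr_gt0// => /(_ isT)[N _ /(_ N (leqnn _))]/=.
  rewrite sub0r normrN ger0_norm ?harmonic_ge0// => ?.
  by exists N.
have k0 : 0 < k.+1%:R^-1 :> R by rewrite invr_gt0.
have : forall i, exists q : rat, ball (x 0 i) (k.+1%:R^-1) (ratr q : R).
  move=> i.
  have : x 0 i < x 0 i + k.+1%:R^-1 by rewrite ltrDl.
  move=> /rat_in_itvoo[q]; rewrite in_itv/= => /andP[xq qx].
  by exists q; rewrite /ball/= distrC ger0_norm ?ltrBlDl// subr_ge0 ltW.
move=> /choice[q qP].
have xq : ball x (k.+1%:R^-1) (map_mx ratr (\row_i q i) : 'rV[R]_n).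
  by split=> // i j; rewrite !mxE (ord1 i); exact: qP.
exists (\row_i q i, k) => /=; last exact: ball_sym.
move=> y qy; apply: xeU; rewrite [e]splitr.
by apply: ball_triangle; [exact: (le_ball (ltW ke) xq)|exact: (le_ball (ltW ke))].
Qed.

Lemma ball_box_rV n (x : 'rV[R]_n) (e : R) : 0 < e ->
  ball x e = box_rV (fun i => ball (x 0 i) e).
Proof.
move=> e0; apply/seteqP; split=> [y [_ xy] i|y xy]; first exact: xy.
by split=> // i j; rewrite (ord1 i); exact: xy.
Qed.

Lemma measurable_fun_rV d (T : measurableType d) n (f : T -> 'rV[R]_n) :
  (forall i, measurable_fun [set: T] (fun t => f t 0 i : RM)) ->
  measurable_fun [set: T] f.
Proof.
move=> mf; apply: (@measurability _ _ _ _ setT f (@open 'rV[R]_n)) => //.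
move=> _ [U oU <-]; rewrite setTI (open_bigcup_ball_rV oU) preimage_bigcup.
rewrite bigcup_mkcond; apply: countable_bigcupT_measurable => // qk.
case: ifPn => // _; rewrite ball_box_rV//.
have -> : f @^-1` box_rV (fun i => ball ((map_mx ratr qk.1 : 'rV[R]_n) 0 i)
      (qk.2.+1%:R^-1)) =
    \bigcap_(i in [set: 'I_n]) ((fun t => f t 0 i : RM) @^-1`
      ball ((map_mx ratr qk.1 : 'rV[R]_n) 0 i) (qk.2.+1%:R^-1)).
  by apply/seteqP; split=> [t Bt i _|t Bt i]; [exact: Bt|exact: (Bt i)].
apply: fin_bigcap_measurable => // i _; rewrite -[X in measurable X]setTI.
by apply: mf => //; exact: measurable_ball.
Qed.

Definition cons_rV n (p : RM * 'rV[R]_n) : 'rV[R]_n.+1 :=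
  row_mx (const_mx p.1 : 'rV[R]_1) p.2.

Lemma cons_rV0 n (p : RM * 'rV[R]_n) : cons_rV p 0 ord0 = p.1.
Proof.
have -> : ord0 = lshift n ord0 :> 'I_(1 + n) by exact/val_inj.
by apply: etrans (row_mxEl _ _ _ _) _; rewrite mxE.
Qed.

Lemma cons_rVS n (p : RM * 'rV[R]_n) i : cons_rV p 0 (lift ord0 i) = p.2 0 i.
Proof.
have -> : lift ord0 i = rshift 1 i :> 'I_(1 + n) by exact/val_inj.
exact: row_mxEr.
Qed.

Lemma preimage_cons_box_rV n (A : 'I_n.+1 -> set R) :
  @cons_rV n @^-1` box_rV A = A ord0 `*` box_rV (fun i => A (lift ord0 i)).
Proof.
apply/seteqP; split=> [p Ap|p [A0 AS] i].
  split=> [|i]; first by have := Ap ord0; rewrite cons_rV0.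
  by have := Ap (lift ord0 i); rewrite cons_rVS.
have [j ->|->] := unliftP ord0 i; first by rewrite cons_rVS; exact: AS.
by rewrite cons_rV0.
Qed.

Lemma measurable_cons_rV n : measurable_fun [set: RM * 'rV[R]_n] (@cons_rV n).
Proof.
apply: measurable_fun_rV => i; have [j ->|->] := unliftP ord0 i.
  rewrite (_ : (fun _ => _) = (fun y : 'rV[R]_n => y 0 j : RM) \o snd).
    exact: measurableT_comp (measurable_coord_rV _) measurable_snd.
  by apply/funext => p; exact: cons_rVS.
rewrite (_ : (fun _ => _) = fst); first exact: measurable_fst.
by apply/funext => p; exact: cons_rV0.
Qed.

Definition behead_rV n (x : 'rV[R]_n.+1) : 'rV[R]_n :=
  \row_i x 0 (lift ord0 i).

Lemma measurable_behead_rV n :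
  measurable_fun [set: 'rV[R]_n.+1] (@behead_rV n).
Proof.
apply: measurable_fun_rV => i.
rewrite (_ : (fun _ => _) = (fun x : 'rV[R]_n.+1 => x 0 (lift ord0 i) : RM)).
  exact: measurable_coord_rV.
by apply/funext => x; rewrite mxE.
Qed.

Section step.
Variables (n : nat) (m : {sigma_finite_measure set 'rV[R]_n -> \bar R}).

Definition lebesgue_step : set 'rV[R]_n.+1 -> \bar R :=
  pushforward (@lebesgue_measure R \x m)%E (@cons_rV n).

Let lebesgue_step0 : lebesgue_step set0 = 0%E.
Proof. by rewrite /lebesgue_step /pushforward preimage_set0 measure0. Qed.

Let lebesgue_step_ge0 A : (0 <= lebesgue_step A)%E.
Proof. by rewrite /lebesgue_step /pushforward measure_ge0. Qed.

Let lebesgue_step_sigma_additive : semi_sigma_additive lebesgue_step.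
Proof.
move=> F mF tF mUF; rewrite /lebesgue_step /pushforward preimage_bigcup.
have mc A : measurable A -> measurable (@cons_rV n @^-1` A).
  by move=> mA; rewrite -[X in measurable X]setTI; exact: measurable_cons_rV.
apply: measure_semi_sigma_additive.
- by move=> i; exact: mc.
- apply/trivIsetP => /= i j _ _ ij; rewrite -preimage_setI.
  by move/trivIsetP : tF => /(_ _ _ _ _ ij) ->//; rewrite preimage_set0.
- by rewrite -preimage_bigcup; exact: mc.
Qed.

HB.instance Definition _ := isMeasure.Build _ _ _ lebesgue_step
  lebesgue_step0 lebesgue_step_ge0 lebesgue_step_sigma_additive.

Let lebesgue_step_sigma_finite : sigma_finite setT lebesgue_step.
Proof.
have /sigma_finiteP[F [FT ndF mF]] := sigma_finiteT (@lebesgue_measure R).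
have /sigma_finiteP[G [GT ndG mG]] := sigma_finiteT m.
pose H i := [set x : 'rV[R]_n.+1 | F i (x 0 ord0) /\ G i (behead_rV x)].
exists H.
  apply/seteqP; split=> // x _.
  have [i _ Fi] : (\bigcup_i F i) (x 0 ord0) by rewrite -FT.
  have [j _ Gj] : (\bigcup_i G i) (behead_rV x) by rewrite -GT.
  exists (maxn i j) => //; split.
    by move: Fi; apply/subsetPset/ndF; rewrite leq_maxl.
  by move: Gj; apply/subsetPset/ndG; rewrite leq_maxr.
move=> i; have [mFi Fioo] := mF i; have [mGi Gioo] := mG i; split.
  apply: measurableI; rewrite -[X in measurable X]setTI.
    exact: measurable_coord_rV.
  exact: measurable_behead_rV.
rewrite /lebesgue_step /pushforward.
have -> : @cons_rV n @^-1` H i = F i `*` G i.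
  have bK p : behead_rV (@cons_rV n p) = p.2.
    by apply/rowP => j; rewrite mxE cons_rVS.
  by apply/funext => p; apply/propext; rewrite /H /= cons_rV0 bK.
by rewrite product_measure1E// lte_mul_pinfty// ge0_fin_numE.
Qed.

HB.instance Definition _ := @Measure_isSigmaFinite.Build _ _ _ lebesgue_step
  lebesgue_step_sigma_finite.

End step.

(* n-dimensional Lebesgue measure, as the n-fold product of the
   one-dimensional one. *)
Fixpoint lebesgue_rV n : {sigma_finite_measure set 'rV[R]_n -> \bar R} :=
  match n with
  | 0%N => dirac (0 : 'rV[R]_0)
  | n'.+1 => lebesgue_step (lebesgue_rV n')
  end.

Lemma lebesgue_rV_box n (A : 'I_n -> set RM) : (forall i, measurable (A i)) ->
  lebesgue_rV n (box_rV A) = (\prod_(i < n) lebesgue_measure (A i))%E.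
Proof.
elim: n A => [|n IH] A mA.
  rewrite big_ord0 /= diracE mem_set//; by case.
rewrite /= /lebesgue_step /pushforward preimage_cons_box_rV.
rewrite product_measure1E//; last exact: measurable_box_rV.
by rewrite IH// big_ord_recl.
Qed.

End Lebesgue_rV.

Section norming.
Context {R : realType} {n : nat}.
Local Notation RV := 'rV[R]_n.
Implicit Types (D E F : set RV) (phi : RV -> R) (u : RV -> \bar R).
Local Open Scope ereal_scope.

Definition domain D := [/\ D !=set0, open D & connected D].

(* The library norm on 'rV[R]_n is the sup norm, so the Euclidean ball is
   spelled out. *)
Definition euclidean_closed_ball (x : RV) (r : R) : set RV :=
  [set y | (\sum_(i < n) (y 0 i - x 0 i) ^+ 2 <= r ^+ 2)%R].

(* Functions on D are total functions whose values outside D are irrelevant. *)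
Definition upper_semicontinuous_on D u :=
  forall x, D x -> forall a : R, u x < a%:E -> \forall y \near x, D y -> u y < a%:E.

(* The integral below is well defined in [-oo, +oo[, since u is bounded above
   on the compact ball. The function -oo is allowed here. *)
Definition subharmonic_on D u :=
  [/\ forall x, D x -> u x < +oo,
      upper_semicontinuous_on D u
    & forall (x : RV) (r : R), (0 < r)%R ->
      euclidean_closed_ball x r `<=` D ->
      u x <= (lebesgue_rV n (euclidean_closed_ball x r))^-1 *
             \int[lebesgue_rV n]_(y in euclidean_closed_ball x r) u y].

Definition negative_subharmonic_on D u :=
  [/\ subharmonic_on D u,
      forall x, D x -> u x <= 0
    & exists2 x, D x & u x != -oo].

Definition weighted_norm E phi u : \bar R :=
  \int[lebesgue_rV n]_(x in E) (`|u x| * (phi x)%:E).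

Definition relatively_compact_in E D := compact (closure E) /\ closure E `<=` D.

Definition subdomain_exhaustion D (Dj : nat -> set RV) :=
  [/\ forall j, domain (Dj j) /\ relatively_compact_in (Dj j) D,
      forall j, Dj j `<=` Dj j.+1
    & \bigcup_j Dj j = D].

Definition norming D phi :=
  [/\ forall x, D x -> (0 < phi x)%R,
      {within D, continuous phi}
    & exists (C : set RV -> R) (eps : (nat -> set RV) -> nat -> R),
      [/\ forall F, compact F -> F `<=` D -> (0 < C F)%R,
          forall Dj, subdomain_exhaustion D Dj ->
            (forall j, (0 < eps Dj j)%R) /\ eps Dj @ \oo --> (0%R : R)
        & forall u, negative_subharmonic_on D u ->
          [/\ weighted_norm D phi u < +oo,
              forall F, compact F -> F `<=` D ->
                forall x, F x -> u x <= - ((C F)%:E * weighted_norm D phi u)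
            & forall Dj, subdomain_exhaustion D Dj ->
                forall j, weighted_norm (D `\` Dj j) phi u <=
                          (eps Dj j)%:E * weighted_norm D phi u]]].

End norming.

(* Main.v *)
(* Write v = |u| for a negative subharmonic u.  The sub-mean value inequality
   over a large ball around z bounds the integral of v over a small ball by a
   multiple of v z for every z in that ball.  Chaining overlapping balls in the
   connected set D makes all local integrals and local infima of v comparable to
   the mass m u of v over one fixed ball, with constants independent of u.  Cover
   D by countably many balls and let phi be the sum of bumps psi k on them, scaled
   so that the integral of v * psi k is at most m u / 2 ^ k.+1.  Then m u and the
   weighted norm of u are comparable; compactness gives the pointwise bound, and
   the N-th tail of the series, which controls the norm outside D_j once D_j
   contains the first N supports, is at most m u / 2 ^ N. *)
Require Import Defs.
From mathcomp Require Import all_boot all_order all_algebra.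
From mathcomp Require Import all_classical all_reals all_analysis.
From mathcomp Require Import measurable_realfun ring lra.
Set Implicit Arguments.
Unset Strict Implicit.
Unset Printing Implicit Defensive.
Import Order.TTheory GRing.Theory Num.Theory.
Import numFieldNormedType.Exports.
Local Open Scope classical_set_scope.
Local Open Scope ring_scope.

(** * Comparison of sup-norm cubes with Euclidean balls *)

Section balls.
Context {R : realType} {n : nat}.
Local Notation RV := 'rV[R]_n.
Local Notation lam := (lebesgue_rV n).

Lemma open_ball_rV (x : RV) (r : R) : open (ball x r).
Proof.
have [r0|r0] := ltP 0 r; first exact: ball_open.
suff -> : ball x r = set0 by exact: open0.
apply/seteqP; split=> // y [r_gt0 _].
by move: (lt_le_trans r_gt0 r0); rewrite ltxx.
Qed.

Lemma ball_rVP (x y : RV) (r : R) : 0 < r ->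
  ball x r y <-> forall i, `|y 0 i - x 0 i| < r.
Proof.
move=> r0; rewrite ball_box_rV//.
by split=> xy i; have := xy i; rewrite /ball /= distrC.
Qed.

Lemma measurable_ball_rV (x : RV) (r : R) : measurable (ball x r).
Proof. by apply: open_measurable_rV; exact: open_ball_rV. Qed.

Lemma lebesgue_ball_rV (x : RV) (r : R) : 0 < r ->
  lam (ball x r) = ((r *+ 2) ^+ n)%:E.
Proof.
move=> r0; rewrite ball_box_rV// lebesgue_rV_box; last first.
  by move=> i; exact: measurable_ball.
under eq_bigr do rewrite lebesgue_measure_ball ?(ltW r0)//.
by rewrite prodEFin prodr_const card_ord.
Qed.

Lemma measurable_euclidean_closed_ball (x : RV) (r : R) :
  measurable (euclidean_closed_ball x r).
Proof.
have mf : measurable_fun [set: RV] (fun y : RV => \sum_(i < n) (y 0 i - x 0 i) ^+ 2).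
  apply: measurable_sum => i; apply: measurable_funX.
  by apply: measurable_funB => //; exact: measurable_coord_rV.
rewrite (_ : euclidean_closed_ball x r =
  setT `&` (fun y : RV => \sum_(i < n) (y 0 i - x 0 i) ^+ 2) @^-1` `]-oo, r ^+ 2]).
  exact: mf.
by rewrite setTI; apply/seteqP; split=> y; rewrite /= in_itv.
Qed.

(** A sum of [n] squares below [r ^+ 2] is at most [n * r ^+ 2], and [n <= n.+1 ^ 2]; this crude
    factor avoids the square root of [n]. *)
Lemma ball_sub_euclidean_closed_ball (x : RV) (r : R) : 0 < r ->
  ball x r `<=` euclidean_closed_ball x (n.+1%:R * r).
Proof.
move=> r0 y /(ball_rVP _ _ r0) xy; rewrite /euclidean_closed_ball/=.
apply: (@le_trans _ _ (\sum_(i < n) r ^+ 2)).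
  apply: ler_sum => i _; rewrite -[leLHS]real_normK ?num_real//.
  by rewrite lerXn2r ?nnegrE// ltW.
rewrite sumr_const card_ord -[leLHS]mulr_natl exprMn ler_wpM2r ?sqr_ge0//.
rewrite -natrX ler_nat (leq_trans (leqnSn n))// -{1}(expn1 n.+1).
by rewrite leq_pexp2l.
Qed.

Lemma euclidean_closed_ball_sub_ball (x : RV) (r s : R) : 0 < r -> r < s ->
  euclidean_closed_ball x r `<=` ball x s.
Proof.
move=> r0 rs y; rewrite /euclidean_closed_ball/= => xy.
apply/(ball_rVP _ _ (lt_trans r0 rs)) => i; apply: le_lt_trans rs.
rewrite -(@ler_pXn2r _ 2)// ?nnegrE ?(ltW r0)// real_normK ?num_real//.
apply: le_trans xy; rewrite (bigD1 i)//= lerDl.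
by apply: sumr_ge0 => j _; exact: sqr_ge0.
Qed.

End balls.

(** * Weak Harnack inequality for negative subharmonic functions *)

Section harnack.
Context {R : realType} {n : nat}.
Local Notation RV := 'rV[R]_n.
Local Notation lam := (lebesgue_rV n).
Implicit Types (D : set RV) (u : RV -> \bar R).
Local Open Scope ereal_scope.

(** Upper semicontinuity makes the trace on [D] of each strict sublevel set open, and such rays
    generate the sigma-algebra of the extended reals. *)
Lemma measurable_negative_subharmonic D u : open D ->
  negative_subharmonic_on D u -> measurable_fun D u.
Proof.
move=> oD [[_ usc _] _ _].
have oU (a : R) : open (D `&` u @^-1` `]-oo, a%:E[).
  rewrite openE => x [Dx]; rewrite /= in_itv/= => uxa.
  have nD : \forall y \near x, D y by exact: open_nbhs_nbhs.
  near=> y; have Dy : D y by near: y.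
  split=> //=; rewrite in_itv/=; move: Dy; near: y.
  exact: usc.
apply: (measurability _ (ErealGenInftyO.measurableE R)) => _ [_ [a ->] <-].
exact: open_measurable_rV.
Unshelve. all: by end_near. Qed.

Lemma measurable_abse_negative_subharmonic D A u : open D -> measurable A ->
  A `<=` D -> negative_subharmonic_on D u -> measurable_fun A (fun x => `|u x|).
Proof.
move=> oD mA AD nu; apply: (measurable_funS (open_measurable_rV oD) AD).
apply: measurableT_comp; first exact: abse_measurable.
exact: measurable_negative_subharmonic.
Qed.

Lemma supermean_negative_subharmonic D u x r : (0 < r)%R ->
  negative_subharmonic_on D u -> D x -> euclidean_closed_ball x r `<=` D ->
  (lam (euclidean_closed_ball x r))^-1 *
    (\int[lam]_(y in euclidean_closed_ball x r) `|u y|) <= `|u x|.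
Proof.
move=> r0 [[_ _ sm] u0 _] Dx rD.
rewrite [leRHS]lee0_abs ?u0// leeNr; apply: le_trans (sm x r r0 rD) _.
rewrite -muleN -integral_ge0N; last by move=> *; exact: abse_ge0.
rewrite [X in _ * X <= _](_ : _ =
  \int[lam]_(y in euclidean_closed_ball x r) - `|u y|)//.
apply: eq_integral => y /[!inE] /rD Dy.
by rewrite lee0_abs ?u0// oppeK.
Qed.

(* For z in the ball, [ball x r] lies in a Euclidean ball around z to which the
   sub-mean value property applies. *)
Lemma local_weak_harnack D x r : open D -> (0 < r)%R ->
  ball x (n.+2%:R * (r *+ 2))%R `<=` D ->
  exists2 C : R, (0 < C)%R & forall u, negative_subharmonic_on D u ->
    forall z, ball x r z -> \int[lam]_(y in ball x r) `|u y| <= C%:E * `|u z|.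
Proof.
move=> oD r0 xD.
have r20 : (0 < r *+ 2)%R by rewrite mulrn_wgt0.
have R0 : (0 < n.+2%:R * (r *+ 2))%R by rewrite mulr_gt0.
(* The volume of a cube around [x] containing the Euclidean ball [E] for every [z] in [ball x r]; it
   depends on neither [u] nor [z]. *)
exists ((n.+2%:R * (r *+ 2) *+ 2) ^+ n)%R; first by rewrite exprn_gt0// mulrn_wgt0.
move=> u nu z xz.
(* [ball z (r *+ 2)] contains [ball x r], and the factor [n.+1%:R] makes the Euclidean ball contain
   that cube. *)
pose s := (n.+1%:R * (r *+ 2))%R.
pose E := euclidean_closed_ball z s.
have s0 : (0 < s)%R by rewrite mulr_gt0.
have rE : ball x r `<=` E.
  apply: subset_trans (ball_sub_euclidean_closed_ball r20) => y xy.
  by rewrite mulr2n; apply: ball_triangle xy; exact: ball_sym.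
have EB : E `<=` ball x (n.+2%:R * (r *+ 2))%R.
  have ss : (s < s + r)%R by rewrite ltrDl.
  move=> y /(euclidean_closed_ball_sub_ball s0 ss) zy.
  rewrite (_ : _ * _ = r + (s + r))%R; first exact: ball_triangle zy.
  by rewrite /s -(natr1 n.+1); ring.
have mE : measurable E by exact: measurable_euclidean_closed_ball.
have mB t : measurable (ball x t) by exact: measurable_ball_rV.
have Dz : D z by exact/xD/EB/rE.
have lamEC : lam E <= ((n.+2%:R * (r *+ 2) *+ 2) ^+ n)%:E.
  rewrite -(lebesgue_ball_rV x R0); apply: le_measure; rewrite ?inE//.
have lamE0 : 0 < lam E.
  apply: (@lt_le_trans _ _ (lam (ball x r))).
    by rewrite lebesgue_ball_rV// lte_fin exprn_gt0// mulrn_wgt0.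
  by apply: le_measure; rewrite ?inE.
have [e lamEe] : exists e : R, lam E = e%:E.
  exists (fine (lam E)); rewrite fineK// ge0_fin_numE//.
  by apply: le_lt_trans lamEC _; exact: ltry.
have := supermean_negative_subharmonic s0 nu Dz (subset_trans EB xD).
rewrite -/E lamEe inver; move: lamE0; rewrite lamEe lte_fin => e0.
rewrite gt_eqF// lee_pdivrMl// => Eu.
apply: (@le_trans _ _ (\int[lam]_(y in E) `|u y|)).
  apply: ge0_subset_integral => //.
  by apply: (measurable_abse_negative_subharmonic oD) => //; exact: subset_trans EB xD.
apply: le_trans Eu _; apply: lee_wpmul2r; first exact: abse_ge0.
by rewrite -lamEe.
Qed.

Lemma le_integral_ball_const D u x r c : open D -> (0 < r)%R ->
  ball x r `<=` D -> negative_subharmonic_on D u ->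
  0 <= c -> (forall z, ball x r z -> c <= `|u z|) ->
  ((r *+ 2) ^+ n)%:E * c <= \int[lam]_(y in ball x r) `|u y|.
Proof.
move=> oD r0 xD nu c0 cu.
have mB : measurable (ball x r) by exact: measurable_ball_rV.
rewrite -(lebesgue_ball_rV x r0) muleC -integral_cst//.
apply: ge0_le_integral => //.
exact: measurable_abse_negative_subharmonic oD mB xD nu.
Qed.

End harnack.

(** * Harnack chains in a connected open set *)

Section chains.
Context {R : realType} {n : nat} (D : set 'rV[R]_n).
Local Notation RV := 'rV[R]_n.
Local Notation lam := (lebesgue_rV n).
Local Open Scope ereal_scope.

(** Here [m u] is a reference mass of [u]. Since [r] and [C] are chosen before [u], the comparison
    is uniform in [u], and chaining preserves this. *)
Definition harnack_comparable (m : (RV -> \bar R) -> \bar R) (y : RV) :=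
  exists r C : R, [/\ (0 < r)%R, (0 < C)%R, ball y r `<=` D &
    forall u, negative_subharmonic_on D u ->
      \int[lam]_(z in ball y r) `|u z| <= C%:E * m u /\
      forall z, ball y r z -> m u <= C%:E * `|u z|].

Lemma open_contains_ball y (k : R) : open D -> D y -> (0 < k)%R ->
  exists2 r : R, (0 < r)%R & ball y (k * r)%R `<=` D.
Proof.
move=> oD Dy k0.
have /nbhs_ballP[e /= e0 yeD] : nbhs y D by exact: open_nbhs_nbhs.
by exists (e / k)%R; [exact: divr_gt0|rewrite mulrC divfK ?gt_eqF].
Qed.

Lemma open_harnack_ball y : open D -> D y ->
  exists2 r : R, (0 < r)%R & ball y r `<=` D /\
    exists2 C : R, (0 < C)%R & forall u, negative_subharmonic_on D u ->
    forall z, ball y r z -> \int[lam]_(z in ball y r) `|u z| <= C%:E * `|u z|.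
Proof.
move=> oD Dy.
have k0 : (0 < n.+2%:R *+ 2 :> R)%R by rewrite mulrn_wgt0.
have [r r0 yrD] := open_contains_ball oD Dy k0.
have yD : ball y (n.+2%:R * (r *+ 2))%R `<=` D.
  by rewrite mulrnAr -mulrnAl.
exists r => //; split; last exact: local_weak_harnack.
apply: subset_trans yD; apply: le_ball.
rewrite mulrnAr -mulrnAl ler_peMl ?(ltW r0)//.
by rewrite -mulr_natr -natrM ler1n.
Qed.

Section mass.
Variables (m : (RV -> \bar R) -> \bar R).
Hypothesis m_ge0 : forall u, 0 <= m u.
Hypothesis oD : open D.

(** A smaller ball inside [ball y r] inherits both bounds with the same [C], by monotonicity of the
    integral. *)
Lemma harnack_comparable_ball y : harnack_comparable m y ->
  \forall z \near y, harnack_comparable m z.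
Proof.
move=> [r [C [r0 C0 yD yC]]].
near=> z.
have : (ball y r)° z.
  by near: z; apply: nbhs_interior; exact: nbhsx_ballx.
rewrite /interior => /nbhs_ballP[e /= e0 ze].
exists e, C; split => //; first exact: subset_trans ze yD.
move=> u nu; have [yu1 yu2] := yC _ nu; split; last by move=> w /ze; exact: yu2.
apply: le_trans yu1; apply: ge0_subset_integral => //.
- exact: measurable_ball_rV.
- exact: measurable_ball_rV.
- by apply: (measurable_abse_negative_subharmonic oD) => //; exact: measurable_ball_rV.
Unshelve. all: by end_near. Qed.

(** A comparable point [w] near [y] gives a ball [ball w t] inside both Harnack balls. The integral
    over this overlap links the two: it dominates multiples of the integral over [ball y r] and of
    [m u], and is dominated by both. *)
Lemma harnack_comparable_closure y : D y -> closure (harnack_comparable m) y ->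
  harnack_comparable m y.
Proof.
move=> Dy cy; have [r r0 [yD [C C0 yC]]] := open_harnack_ball oD Dy.
have [w [[s [C' [s0 C'0 wD wC']]] yw]] := cy _ (nbhsx_ballx y _ r0).
have [t [t0 wyt wst]] : exists t : R, [/\ (0 < t)%R, ball w t `<=` ball y r &
    ball w t `<=` ball w s].
  have : nbhs w (ball y r `&` ball w s).
    apply: filterI; last exact: nbhsx_ballx.
    by apply: open_nbhs_nbhs; split; [exact: open_ball_rV|].
  move=> /nbhs_ballP[t /= t0 wt]; exists t.
  by split=> // z /wt[].
have c0 : (0 < (t *+ 2) ^+ n)%R by rewrite exprn_gt0// mulrn_wgt0.
have wtD : ball w t `<=` D by exact: subset_trans wD.
have mt x e : measurable (ball x e : set RV) by exact: measurable_ball_rV.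
have mon u (A B : set RV) : negative_subharmonic_on D u ->
    measurable A -> measurable B -> A `<=` B -> B `<=` D ->
    \int[lam]_(z in A) `|u z| <= \int[lam]_(z in B) `|u z|.
  move=> nu mA mB AB BD; apply: ge0_subset_integral => //.
  exact: (measurable_abse_negative_subharmonic oD).
(* [C] comes from the ball at [y], [C'] from comparability at [w], and the denominator is the volume
   of [ball w t]. *)
exists r, (C * C' / (t *+ 2) ^+ n)%R; split => //.
  by rewrite divr_gt0// mulr_gt0.
move=> u nu; have [wu1 wu2] := wC' u nu; have yu := yC u nu.
have vol_le (k : R) v : (0 < k)%R ->
    (forall z, ball w t z -> v <= k%:E * `|u z|) -> 0 <= v ->
    ((t *+ 2) ^+ n)%:E * ((k^-1)%:E * v) <= \int[lam]_(z in ball w t) `|u z|.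
  move=> k0 vu v0; apply: (le_integral_ball_const oD t0 wtD nu).
    by rewrite mule_ge0// lee_fin invr_ge0 ltW.
  by move=> z wz; rewrite lee_pdivrMl// vu.
have EM (a b : R) (x : \bar R) : a%:E * (b%:E * x) = (a * b)%:E * x.
  by rewrite muleA -EFinM.
split=> [|z yz].
  have : ((t *+ 2) ^+ n)%:E *
      ((C^-1)%:E * (\int[lam]_(z in ball y r) `|u z|)) <= C'%:E * m u.
    apply: le_trans (vol_le _ _ C0 _ _) _.
    + by move=> z /wyt; exact: yu.
    + exact: integral_ge0.
    + by apply: le_trans wu1; exact: mon.
  (* The coefficient is rewritten as a single inverse so that it can move to the other side. *)
  rewrite EM -{1}(invrK ((t *+ 2) ^+ n)%R) -invfM lee_pdivrMl; last first.
    by rewrite mulr_gt0 ?invr_gt0.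
  rewrite EM => /le_trans; apply.
  by rewrite le_eqVlt (_ : _ * _ = C * C' / (t *+ 2) ^+ n)%R ?eqxx//; ring.
have : ((t *+ 2) ^+ n)%:E * ((C'^-1)%:E * m u) <= C%:E * `|u z|.
  apply: le_trans (vol_le _ _ C'0 _ _) _.
  + by move=> x /wst; exact: wu2.
  + exact: m_ge0.
  + by apply: le_trans (yu _ yz); exact: mon.
rewrite EM -{1}(invrK ((t *+ 2) ^+ n)%R) -invfM lee_pdivrMl; last first.
  by rewrite mulr_gt0 ?invr_gt0.
rewrite EM => /le_trans; apply.
by rewrite le_eqVlt (_ : _ * _ = C * C' / (t *+ 2) ^+ n)%R ?eqxx//; ring.
Qed.

End mass.

(** The mass is the integral over a Harnack ball at a fixed point. The comparable points form a
    nonempty, open and relatively closed part of [D], so connectedness applies. *)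
Lemma domain_harnack_comparable : domain D ->
  exists2 m : (RV -> \bar R) -> \bar R, (forall u, 0 <= m u) &
    forall y, D y -> harnack_comparable m y.
Proof.
move=> [[x0 Dx0] oD cD].
have [r r0 [rD [C C0 rC]]] := open_harnack_ball oD Dx0.
pose m (u : RV -> \bar R) := \int[lam]_(z in ball x0 r) `|u z|.
have m_ge0 u : 0 <= m u by exact: integral_ge0.
exists m => //.
pose H := harnack_comparable m.
suff <- : D `&` H = D by move=> y [].
have Hx0 : H x0.
  (* The 1 serves the integral bound, where the integral is [m u] itself; [C] serves the pointwise
     bound. *)
  exists r, (Num.max 1 C)%R; split => //; first by rewrite lt_max ltr01.
  move=> u nu; split.
    by apply: lee_pemull; [exact: m_ge0|rewrite lee_fin le_max lexx].
  move=> z /(rC u nu)/le_trans; apply; apply: lee_wpmul2r => //.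
  by rewrite lee_fin le_max lexx orbT.
apply: cD; first by exists x0.
  exists H => //; rewrite openE => y; exact: harnack_comparable_ball.
exists (closure H); first exact: closed_closure.
apply/seteqP; split=> y [Dy Hy]; split => //; first exact: subset_closure.
exact: harnack_comparable_closure.
Qed.

(** Near each point every large enough constant works; the near-covering form of compactness, for
    the filter at [+oo], gives one constant for all of [F]. *)
Lemma compact_harnack (m : (RV -> \bar R) -> \bar R) (F : set RV) :
  (forall y, F y -> harnack_comparable m y) -> compact F ->
  exists2 C : R, (0 < C)%R & forall u, negative_subharmonic_on D u ->
    forall x, F x -> m u <= C%:E * `|u x|.
Proof.
move=> FH /compact_near_coveringP cF.
have [|M [_ MP]] := cF R +oo%R (fun C x => forall u,
    negative_subharmonic_on D u -> m u <= C%:E * `|u x|) _.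
  move=> y Fy; have [r [C [r0 C0 yD yC]]] := FH y Fy.
  exists (ball y r, [set t | C < t]%R) => /=.
    by split; [exact: nbhsx_ballx|exists C; split; rewrite ?num_real].
  move=> [z t] [/= yz Ct] u nu; have [_ /(_ z yz)/le_trans] := yC u nu; apply.
  by apply: lee_wpmul2r => //; rewrite lee_fin ltW.
exists (Num.max M 0 + 1)%R; first by rewrite ltr_wpDl// le_max lexx orbT.
move=> u nu x Fx; apply: MP => //.
by rewrite ltr_pwDr// le_max lexx.
Qed.

End chains.

(** * Series of nonnegative terms and uniform limits *)

Section series.
Context {R : realType}.
Local Open Scope ereal_scope.

(* Unlike [nneseriesZl], the factor may be [+oo]. *)
Lemma nneseries_muler (f : nat -> \bar R) (c : \bar R) : 0 <= c ->
  (forall k, 0 <= f k) ->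
  \sum_(0 <= k <oo) (c * f k) = c * \sum_(0 <= k <oo) f k.
Proof.
case: c => [c c0 f0|_ f0|//]; first exact: nneseriesZl.
have [f_eq0|/existsNP[k /eqP fk]] := pselect (forall k, f k = 0).
  by rewrite !eseries0 ?mule0// => k _ _; rewrite f_eq0 ?mule0.
have fk0 : 0 < f k by rewrite lt0e fk f0.
have sf0 : 0 < \sum_(0 <= k <oo) f k.
  apply: (lt_le_trans fk0).
  apply: le_trans (nneseries_lim_ge k.+1 _); last by [].
  rewrite big_nat_recr//= leeDr//.
  by apply: sume_ge0 => i _.
rewrite [RHS]gt0_mulye// (@nneseries_pinfty _ _ _ k)//=.
  by move=> i _; rewrite mule_ge0.
by rewrite gt0_mulye.
Qed.

(** After a shift by [N], the terms are bounded by [c / 2 ^+ N] times those of a geometric series of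
    sum 1. *)
Lemma nneseries_half_tail (f : nat -> \bar R) (c : R) (N : nat) : (0 <= c)%R ->
  (forall k, 0 <= f k) -> (forall k, f k <= (c / 2 ^+ k.+1)%:E) ->
  \sum_(N <= k <oo) f k <= (c / 2 ^+ N)%:E.
Proof.
move=> c0 f0 fc; rewrite -nneseries_addn//.
have cN : (0 <= c / 2 ^+ N)%R by rewrite divr_ge0// exprn_ge0.
apply: le_trans (epsilon_trick0 xpredT cN).
apply: lee_nneseries => // k _; apply: le_trans (fc _) _.
rewrite lee_fin natrX -mulrA -invfM -exprD.
by rewrite addnS addnC.
Qed.

Lemma exists_half_exp_le (e : R) : (0 < e)%R ->
  exists N, ((2 ^+ N)^-1 <= e)%R.
Proof.
move=> e0.
have half_lt1 : (`|2^-1| < 1 :> R)%R by rewrite ger0_norm// invf_lt1// ltr1n.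
have /cvgrPdist_le/(_ e e0)[N _ /(_ N (leqnn _))] := cvg_expr half_lt1.
rewrite sub0r normrN ger0_norm ?exprn_ge0// exprVn => Ne.
by exists N.
Qed.

Lemma continuous_uniform_approx (T : topologicalType) (f : T -> R) :
  (forall e : R, (0 < e)%R -> exists2 g : T -> R, continuous g &
    forall x, (`|f x - g x| <= e)%R) -> continuous f.
Proof.
move=> fg x; apply/cvgrPdist_le => e e0.
have e3 : (0 < e / 3)%R by rewrite divr_gt0.
have [g cg gf] := fg _ e3.
have := cg x => /cvgrPdist_le /(_ _ e3) ngx.
near=> y.
have gxy : (`|g x - g y| <= e / 3)%R by near: y.
have := gf x; have := gf y; move: gxy.
rewrite !ler_norml => /andP[? ?] /andP[? ?] /andP[? ?].
by apply/andP; split; lra.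
Unshelve. all: by end_near. Qed.

End series.

(** * Sum of a geometrically bounded series of functions *)

Section weight.
Context {R : realType} {T : topologicalType} (psi : nat -> T -> R).
Hypothesis psi_continuous : forall k, continuous (psi k).
Hypothesis psi_ge0 : forall k x, 0 <= psi k x.
Hypothesis psi_le : forall k x, psi k x <= (2 ^+ k.+1)^-1.
Local Open Scope ereal_scope.

(** The nonnegative series is summed in the extended reals; [psi_le] makes it finite, so [fine]
    loses nothing. *)
Definition weight_sum (x : T) : R := fine (\sum_(0 <= k <oo) (psi k x)%:E).

Let psi_tail x N : 0 <= \sum_(N <= k <oo) (psi k x)%:E <= ((2 ^+ N)^-1)%:E.
Proof.
apply/andP; split; first by apply: nneseries_ge0 => k _ _; rewrite lee_fin.
rewrite -[X in X%:E](mul1r); apply: nneseries_half_tail => // k.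
  by rewrite lee_fin.
by rewrite mul1r lee_fin.
Qed.

Lemma weight_sumE x : (weight_sum x)%:E = \sum_(0 <= k <oo) (psi k x)%:E.
Proof.
have /andP[s0 s1] := psi_tail x 0.
by rewrite /weight_sum fineK// ge0_fin_numE// (le_lt_trans s1)// ltry.
Qed.

Lemma psi_le_weight_sum k x : (psi k x <= weight_sum x)%R.
Proof.
rewrite -lee_fin weight_sumE.
apply: le_trans (nneseries_lim_ge k.+1 _).
  rewrite big_nat_recr//= leeDr//; apply: sume_ge0 => i _.
  by rewrite lee_fin.
by move=> i _ _; rewrite lee_fin.
Qed.

(** As in the Weierstrass test: partial sums are continuous and the remainders are small uniformly
    in [x]. *)
Lemma continuous_weight_sum : continuous weight_sum.
Proof.
apply: continuous_uniform_approx => e e0.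
have [N Ne] := exists_half_exp_le e0.
exists (fun x => \sum_(0 <= k < N) psi k x)%R.
  elim: N {Ne} => [|N IH].
    under eq_fun do rewrite big_nil; exact: cst_continuous.
  under eq_fun do rewrite big_nat_recr//=.
  by move=> x; apply: cvgD; [exact: IH|exact: psi_continuous].
move=> x; have /andP[t0 tN] := psi_tail x N.
apply: le_trans Ne; rewrite -lee_fin; apply: le_trans tN.
have : (weight_sum x)%:E = (\sum_(0 <= k < N) psi k x)%R%:E +
    \sum_(N <= k <oo) (psi k x)%:E.
  rewrite weight_sumE (nneseries_split 0 N); last by move=> k _; rewrite lee_fin.
  by rewrite add0n sumEFin.
move: t0; case: (\sum_(N <= k <oo) _) => [t||]//; rewrite ?leey//.
by rewrite -EFinD lee_fin => t0 [->]; rewrite addrC addKr lee_fin ger0_norm.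
Qed.

End weight.

Lemma continuous_norm_sub (R : realType) (V : normedModType R) (q : V) :
  continuous (fun x : V => `|q - x| : R).
Proof.
by move=> x; apply: cvg_norm; apply: cvgB; [exact: cvg_cst|exact: cvg_id].
Qed.

(** * Compactly supported bumps with controlled weighted mass *)

Section bumps.
Context {R : realType} {n : nat} (D : set 'rV[R]_n).
Local Notation RV := 'rV[R]_n.
Local Notation lam := (lebesgue_rV n).
Variable m : (RV -> \bar R) -> \bar R.
Hypothesis m_ge0 : forall u, (0 <= m u)%E.
Hypothesis oD : open D.
Local Open Scope ereal_scope.

Lemma continuous_measurable_rV (f : RV -> R) : continuous f ->
  measurable_fun [set: RV] f.
Proof.
move=> cf; apply: (measurability _ (RGenOpens.measurableE R)).
move=> _ [_ [a [b ->]] <-].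
rewrite setTI; apply: open_measurable_rV.
by apply: open_comp (interval_open _ _) => // x _; exact: cf.
Qed.

Lemma compact_closed_ball_rV (x : RV) (r : R) : (0 < r)%R ->
  compact (closed_ball x r).
Proof.
move=> r0; apply: bounded_closed_compact; last exact: closed_ball_closed.
exists (`|x| + r)%R; split; first by rewrite num_real.
move=> M xrM y; rewrite closed_ballE// /closed_ball_/= => xy.
apply: le_trans (ltW xrM); rewrite -lerBlDl.
by apply: le_trans xy; rewrite distrC lerB_dist.
Qed.

(** The same [e] bounds the height, for uniform convergence of the sum, and the weighted mass, for
    the norm estimates; [K] will be absorbed by any exhaustion. *)
Definition bump (e : R) (f : RV -> R) :=
  [/\ continuous f,
      forall x, (0 <= f x <= e)%R,
      exists2 K, compact K & K `<=` D /\ forall x, ~ K x -> f x = 0%R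
    & forall u, negative_subharmonic_on D u ->
        \int[lam]_(x in D) (`|u x| * (f x)%:E) <= e%:E * m u].

Lemma bump0 e : (0 <= e)%R -> bump e (fun=> 0%R).
Proof.
move=> e0; split.
- exact: cst_continuous.
- by move=> x; rewrite lexx.
- by exists set0; [exact: compact0|split].
- move=> u _; rewrite integral0_eq; last by move=> x _; rewrite mule0.
  by rewrite mule_ge0.
Qed.

(** The bump is the tent [t] scaled by [e / (C + 1)]; the denominator exceeds both 1 and [C], which
    gives the height and the mass bound respectively. *)
Lemma exists_bump_on_ball (q : RV) (r C e : R) : (0 < r)%R -> (0 < C)%R -> (0 < e)%R ->
  closed_ball q r `<=` D ->
  (forall u, negative_subharmonic_on D u ->
    \int[lam]_(x in ball q r) `|u x| <= C%:E * m u) ->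
  exists2 f, bump e f & forall x, ball q r x -> (0 < f x)%R.
Proof.
move=> r0 C0 e0 qD qC.
have C1 : (0 < C + 1)%R by rewrite ltr_wpDl// ltW.
pose t (x : RV) := Num.max 0%R (1 - `|q - x| / r)%R.
have t_ge0 x : (0 <= t x)%R by rewrite le_max lexx.
have t_le1 x : (t x <= 1)%R.
  by rewrite ge_max ler01/= lerBlDr lerDl divr_ge0// ltW.
have t_gt0 x : ball q r x -> (0 < t x)%R.
  rewrite -ball_normE /ball_/= => qx.
  by rewrite lt_max subr_gt0 ltr_pdivrMr// mul1r qx orbT.
have t_out x : ~ ball q r x -> t x = 0%R.
  rewrite -ball_normE /ball_/= => /negP; rewrite -leNgt => rq.
  by apply/max_idPl; rewrite subr_le0 ler_pdivlMr// mul1r.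
have ct : continuous t.
  have cdist : continuous (fun x : RV => (1 - `|q - x| / r)%R : R).
    have affine : continuous (fun s : R => (1 - s / r)%R : R).
      move=> s; apply: (@cvgB R R^o); first exact: cvg_cst.
      by apply: cvgMr_tmp; exact: cvg_id.
    by move=> x; exact: (cvg_comp _ _ (@continuous_norm_sub R RV q x) (affine _)).
  move=> x; apply: (@continuous_max R RV (fun=> 0%R)); last exact: cdist.
  exact: cst_continuous.
pose f x := (e / (C + 1) * t x)%R.
have eC0 : (0 < e / (C + 1))%R by rewrite divr_gt0.
have qrD : ball q r `<=` D by apply: subset_trans qD; exact: subset_closed_ball.
have cf : continuous f.
  have scale : continuous (fun s : R => (e / (C + 1) * s)%R : R).
    by move=> s; apply: cvgMl_tmp; exact: cvg_id.
  by move=> x; exact: (cvg_comp _ _ (ct x) (scale _)).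
have f_ge0 x : (0 <= f x)%R by rewrite mulr_ge0// ltW.
have mB : measurable (ball q r) by exact: measurable_ball_rV.
exists f; last by move=> x qx; rewrite mulr_gt0// t_gt0.
split=> //.
- move=> x; rewrite f_ge0/= /f mulrAC ler_pdivrMr// ler_wpM2l ?(ltW e0)//.
  by rewrite (le_trans (t_le1 x))// lerDr ltW.
- exists (closed_ball q r); first exact: compact_closed_ball_rV.
  split=> // x qx; rewrite /f t_out ?mulr0// => /subset_closed_ball.
  by [].
move=> u nu.
have mu : measurable_fun (ball q r) (fun x => `|u x|).
  exact: (measurable_abse_negative_subharmonic oD).
have mf : measurable_fun (ball q r) (fun x => (f x)%:E).
  apply/measurable_EFinP; apply: measurable_funS (continuous_measurable_rV cf) => //.
have -> : \int[lam]_(x in D) (`|u x| * (f x)%:E) =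
    \int[lam]_(x in ball q r) (`|u x| * (f x)%:E).
  rewrite [RHS]integral_mkcond [LHS]integral_mkcond.
  apply: eq_integral => x _; rewrite !patchE.
  have [Dx|Dx] := pselect (D x); have [qx|qx] := pselect (ball q r x).
  - by rewrite !mem_set.
  - by rewrite mem_set// memNset// /f t_out// mulr0 mule0.
  - by exfalso; apply: Dx; exact: qrD.
  - by rewrite !memNset.
apply: (@le_trans _ _ (\int[lam]_(x in ball q r) ((e / (C + 1))%:E * `|u x|))).
  apply: ge0_le_integral => //.
  - by move=> x _; rewrite mule_ge0// lee_fin.
  - exact: emeasurable_funM.
  - exact: measurable_funeM.
  - move=> x _; rewrite muleC lee_wpmul2r// lee_fin /f.
    by rewrite -[leRHS]mulr1 ler_wpM2l ?t_le1// ltW.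
rewrite ge0_integralZl_EFin//; last exact: ltW.
apply: (@le_trans _ _ ((e / (C + 1))%:E * (C%:E * m u))).
  by rewrite lee_wpmul2l ?qC// lee_fin ltW.
rewrite muleA -EFinM lee_wpmul2r// lee_fin mulrAC ler_pdivrMr//.
by rewrite ler_wpM2l ?(ltW e0)// lerDl.
Qed.

(** Balls with rational centre and radius [i.+1%:R^-1], coded by [pickle], reduce the cover of [D]
    to a countable one. *)
Lemma exists_bump_family :
  (forall y, D y -> harnack_comparable D m y) ->
  exists psi : nat -> RV -> R,
    (forall k, bump (2 ^+ k.+1)^-1 (psi k)) /\
    forall x, D x -> exists k, (0 < psi k x)%R.
Proof.
move=> DH.
pose good (p : 'rV[rat]_n * nat) (q : RV) (r : R) :=
  [/\ q = map_mx ratr p.1, r = (p.2.+1%:R^-1)%R, closed_ball q r `<=` D &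
    exists2 C : R, (0 < C)%R & forall u, negative_subharmonic_on D u ->
      \int[lam]_(x in ball q r) `|u x| <= C%:E * m u].
have step k : exists f : RV -> R, bump (2 ^+ k.+1)^-1 f /\
    forall p q r, unpickle k = Some p -> good p q r ->
      forall x, ball q r x -> (0 < f x)%R.
  have k0 : (0 < (2 ^+ k.+1)^-1 :> R)%R by rewrite invr_gt0 exprn_gt0.
  (* Indices that code no ball, or an unsuitable one, get the zero bump. *)
  case: (unpickle k) => [p|]; last first.
    by exists (fun=> 0%R); split => //; apply: bump0; exact: ltW.
  have [[q [r gp]]|ngp] := pselect (exists q r, good p q r); last first.
    exists (fun=> 0%R); split; first by apply: bump0; exact: ltW.
    by move=> _ q r [<-] gp; exfalso; apply: ngp; exists q, r.
  have [qE rE qD [C C0 qC]] := gp.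
  have r0 : (0 < r)%R by rewrite rE invr_gt0.
  have [f bf fq] := exists_bump_on_ball r0 C0 k0 qD qC.
  by exists f; split=> // p' q' r' [<-] [-> -> _ _]; rewrite -qE -rE.
have [psi psiP] := choice step.
exists psi; split=> [k|x Dx]; first by have [] := psiP k.
have [r [C [r0 C0 xD xC]]] := DH x Dx.
have r20 : (0 < r / 2)%R by rewrite divr_gt0.
have : ball x (r / 2)%R x by exact: ballxx.
(* Covering the half ball keeps the closure of the rational ball inside [ball x r], hence inside
   [D]. *)
rewrite (open_bigcup_ball_rV (@open_ball_rV _ _ x (r / 2)%R)) => -[p /= px qx].
exists (pickle p); have [_ /(_ _ _ _ (pickleK p) _ x qx)] := psiP (pickle p).
apply; split=> //.
  apply: subset_trans xD; apply: subset_trans (subset_closure_half r0).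
  exact: closureS.
exists C => // u nu; have [+ _] := xC _ nu; apply: le_trans.
have xr2 : ball x (r / 2)%R `<=` ball x r.
  by apply: le_ball; rewrite ler_pdivrMr// ler_pMr// ler1n.
apply: ge0_subset_integral => //; [exact: measurable_ball_rV..| |].
  by apply: (measurable_abse_negative_subharmonic oD) => //; exact: measurable_ball_rV.
exact: subset_trans px xr2.
Qed.

End bumps.

(** The infimum of the admissible [e >= 0] tends to 0. Adding [j.+1%:R^-1] makes it positive and
    exceeds some admissible value, so [Q j] holds by monotonicity. *)
Lemma exists_vanishing_sequence (R : realType) (Q : nat -> R -> Prop) :
  (forall j, Q j 1) ->
  (forall j e e', e <= e' -> Q j e -> Q j e') ->
  (forall e, 0 < e -> \forall j \near \oo, Q j e) ->
  exists eps : nat -> R, [/\ forall j, 0 < eps j, eps @ \oo --> (0 : R) &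
    forall j, Q j (eps j)].
Proof.
move=> Q1 Qmono Qe.
pose S j := [set e | 0 <= e /\ Q j e].
have Slb j : lbound (S j) 0 by move=> e [].
have Sinf j : has_inf (S j).
  by split; [exists 1; split; [exact: ler01|exact: Q1]|exists 0; exact: Slb].
have inf0 j : 0 <= inf (S j) by apply: lb_le_inf; [case: (Sinf j)|exact: Slb].
exists (fun j => inf (S j) + j.+1%:R^-1); split.
- by move=> j; rewrite ltr_wpDl// invr_gt0.
- apply/cvgrPdist_le => e e0.
  have e20 : 0 < e / 2 by rewrite divr_gt0.
  have /cvgrPdist_le/(_ _ e20) nh := @cvg_harmonic R.
  near=> j.
  have infe : inf (S j) <= e / 2.
    apply: ge_inf; first by case: (Sinf j).
    by split; [exact: ltW|near: j; exact: Qe].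
  have : `|0 - j.+1%:R^-1| <= e / 2 by near: j.
  rewrite !sub0r !normrN [X in X <= _ -> _]ger0_norm ?invr_ge0// => hj.
  by rewrite ger0_norm ?addr_ge0 ?invr_ge0// [e]splitr lerD.
- move=> j; have j0 : 0 < j.+1%:R^-1 :> R by rewrite invr_gt0.
  have [e [_ Qje] /ltW eS] := inf_adherent j0 (Sinf j).
  exact: Qmono Qje.
Unshelve. all: by end_near. Qed.

(** * Norming estimates for the weight *)

Section weighted_norm_bounds.
Context {R : realType} {n : nat} (D : set 'rV[R]_n).
Local Notation RV := 'rV[R]_n.
Local Notation lam := (lebesgue_rV n).
Variables (m : (RV -> \bar R) -> \bar R) (psi : nat -> RV -> R).
Hypothesis m_ge0 : forall u, (0 <= m u)%E.
Hypothesis domD : domain D.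
Hypothesis DH : forall y, D y -> harnack_comparable D m y.
Hypothesis psi_bump : forall k, bump D m (2 ^+ k.+1)^-1 (psi k).
Hypothesis psi_gt0 : forall x, D x -> exists k, 0 < psi k x.
Local Open Scope ereal_scope.

Let phi := weight_sum psi.

Let oD : open D. Proof. by case: domD. Qed.

Let cpsi k : continuous (psi k). Proof. by case: (psi_bump k). Qed.

Let psi_ge0 k x : (0 <= psi k x)%R.
Proof. by have [_ /(_ x)/andP[]] := psi_bump k. Qed.

Let psi_le k x : (psi k x <= (2 ^+ k.+1)^-1)%R.
Proof. by have [_ /(_ x)/andP[]] := psi_bump k. Qed.

Let cphi : continuous phi. Proof. exact: continuous_weight_sum. Qed.

Lemma weight_sum_gt0 x : D x -> (0 < phi x)%R.
Proof.
by move=> /psi_gt0[k /lt_le_trans]; apply; exact: psi_le_weight_sum.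
Qed.

Section fixed_function.
Variable u : RV -> \bar R.
Hypothesis nu : negative_subharmonic_on D u.

Let measurable_weighted E (f : RV -> R) : measurable E -> E `<=` D ->
  continuous f -> measurable_fun E (fun x => `|u x| * (f x)%:E).
Proof.
move=> mE ED cf; apply: emeasurable_funM.
  exact: (measurable_abse_negative_subharmonic oD).
by apply/measurable_EFinP; apply: measurable_funS (continuous_measurable_rV cf).
Qed.

(** The pointwise bound at one point of [D] where [u] is finite controls the mass. *)
Lemma mass_lty : m u < +oo.
Proof.
have [_ u0 [x Dx uxNy]] := nu.
have [r [C [r0 C0 _ /(_ u nu)[_ /(_ x)]]]] := DH Dx.
have xx : ball x r x by exact: ballxx.
move=> /(_ xx)/le_lt_trans; apply.
have : u x \is a fin_num by rewrite fin_numE uxNy lt_eqF// (le_lt_trans (u0 x Dx)).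
by move=> /fineK <-; rewrite -EFinM ltry.
Qed.

(** Integrating the series termwise, the first [N] terms vanish on [E] and the mass bounds of the
    bumps sum geometrically. The case [N = 0] bounds the full norm. *)
Lemma weighted_norm_tail E N : measurable E -> E `<=` D ->
  (forall k, (k < N)%N -> forall x, E x -> psi k x = 0%R) ->
  weighted_norm E phi u <= ((2 ^+ N)^-1)%:E * m u.
Proof.
move=> mE ED E0.
have -> : weighted_norm E phi u =
    \sum_(0 <= k <oo) \int[lam]_(x in E) (`|u x| * (psi k x)%:E).
  rewrite -integral_nneseries//; first last.
  - by move=> k x _; rewrite mule_ge0// lee_fin.
  - by move=> k; exact: measurable_weighted.
  apply: eq_integral => x _; rewrite weight_sumE//.
  by rewrite nneseries_muler// => k; rewrite lee_fin.
have term_ge0 k : 0 <= \int[lam]_(x in E) (`|u x| * (psi k x)%:E).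
  by apply: integral_ge0 => x _; rewrite mule_ge0// lee_fin.
(* Finiteness of [m u] lets it serve as the real constant in the geometric tail bound. *)
have mE' : m u = (fine (m u))%:E by rewrite fineK// ge0_fin_numE ?mass_lty.
rewrite (nneseries_split 0 N)// add0n big_nat big1 ?add0e; last first.
  move=> k /andP[_ kN]; apply: integral0_eq => x Ex.
  by rewrite E0// mule0.
rewrite mE' -EFinM mulrC; apply: nneseries_half_tail => //.
  by rewrite -lee_fin -mE'.
move=> k; rewrite EFinM -mE' muleC.
have [_ _ _ /(_ u nu)] := psi_bump k; apply: le_trans.
apply: ge0_subset_integral => //.
- exact: open_measurable_rV.
- by apply: measurable_weighted => //; exact: open_measurable_rV.
- by move=> x _; rewrite mule_ge0// lee_fin.
Qed.

Lemma weighted_norm_le_mass : weighted_norm D phi u <= m u.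
Proof.
have := @weighted_norm_tail D 0 (open_measurable_rV oD) (fun _ => id).
by rewrite expr0 invr1 mul1e; exact.
Qed.

Lemma le_weighted_norm E F : measurable E -> measurable F -> E `<=` F ->
  F `<=` D -> weighted_norm E phi u <= weighted_norm F phi u.
Proof.
move=> mE mF EF FD; apply: ge0_subset_integral => //.
  exact: measurable_weighted.
by move=> x /FD Dx; rewrite mule_ge0// lee_fin ltW// weight_sum_gt0.
Qed.

End fixed_function.

(** On a small ball around a point [x0], continuity keeps [phi] above half of [phi x0] and
    comparability bounds the modulus of [u] below by a multiple of [m u]; integrating gives the
    claim. *)
Lemma mass_le_weighted_norm : exists2 K : R, (0 < K)%R &
  forall u, negative_subharmonic_on D u -> m u <= K%:E * weighted_norm D phi u.
Proof.
have [[x0 Dx0] _ _] := domD.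
have [r [C [r0 C0 rD rC]]] := DH Dx0.
pose c := (phi x0 / 2)%R.
have phi0 : (0 < phi x0)%R := weight_sum_gt0 Dx0.
have c0 : (0 < c)%R by rewrite divr_gt0.
have [t [t0 tr tc]] : exists t : R, [/\ (0 < t)%R, ball x0 t `<=` ball x0 r &
    forall z, ball x0 t z -> (c <= phi z)%R].
  have /cvgrPdist_le/(_ _ c0) nc := @cphi x0.
  have : nbhs x0 (ball x0 r `&` [set z | `|phi x0 - phi z| <= c]%R).
    by apply: filterI => //; exact: nbhsx_ballx.
  move=> /nbhs_ballP[t /= t0 xt]; exists t; split=> // z /xt[]//= _.
  by rewrite ler_distlC => /andP[+ _]; rewrite /c; lra.
have v0 : (0 < (t *+ 2) ^+ n)%R by rewrite exprn_gt0// mulrn_wgt0.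
have tD : ball x0 t `<=` D by exact: subset_trans rD.
have mt : measurable (ball x0 t) by exact: measurable_ball_rV.
exists (C * (c * (t *+ 2) ^+ n)^-1)%R; first by rewrite mulr_gt0// invr_gt0 mulr_gt0.
move=> u nu.
have mu : measurable_fun (ball x0 t) (fun x => `|u x|).
  exact: (measurable_abse_negative_subharmonic oD).
have : c%:E * (((t *+ 2) ^+ n)%:E * ((C^-1)%:E * m u)) <= weighted_norm D phi u.
  apply: le_trans (@le_weighted_norm u nu (ball x0 t) D mt _ tD _) => //; last first.
    exact: open_measurable_rV.
  apply: (@le_trans _ _ (\int[lam]_(x in ball x0 t) (c%:E * `|u x|))).
    rewrite ge0_integralZl_EFin//; last exact: ltW.
    apply: lee_wpmul2l; first by rewrite lee_fin ltW.
    apply: (le_integral_ball_const oD t0 tD nu).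
      by rewrite mule_ge0// lee_fin invr_ge0 ltW.
    move=> z /tr rz; rewrite lee_pdivrMl//.
    by have [_] := rC u nu; apply.
  apply: ge0_le_integral => //.
  - by move=> x _; rewrite mule_ge0// lee_fin ltW.
  - exact: measurable_funeM.
  - apply: emeasurable_funM => //; apply/measurable_EFinP.
    exact: measurable_funS (continuous_measurable_rV cphi).
  - by move=> x tx; rewrite muleC lee_wpmul2l// lee_fin tc.
rewrite !muleA -!EFinM.
have -> : (c * (t *+ 2) ^+ n / C = (C * (c * (t *+ 2) ^+ n)^-1)^-1)%R.
  by rewrite invfM invrK mulrC.
by rewrite lee_pdivrMl// mulr_gt0// invr_gt0 mulr_gt0.
Qed.

Lemma exhaustion_covers_compact (Dj : nat -> set RV) (F : set RV) :
  subdomain_exhaustion D Dj -> compact F -> F `<=` D ->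
  \forall j \near \oo, F `<=` Dj j.
Proof.
move=> [domDj Djs Dju] /compact_near_coveringP cF FD.
have Djle i j : (i <= j)%N -> Dj i `<=` Dj j.
  elim: j => [|j IH]; first by rewrite leqn0 => /eqP ->.
  rewrite leq_eqVlt => /predU1P[->//|]; rewrite ltnS => /IH ij.
  exact: subset_trans ij (Djs j).
apply: cF => y /FD; rewrite -Dju => -[i _ Diy].
have [[_ oDi _] _] := domDj i.
exists (Dj i, [set j | (i <= j)%N]) => /=.
  by split; [exact: open_nbhs_nbhs|exists i].
by move=> [z j] [/= Diz ij]; exact: Djle ij _ Diz.
Qed.

Lemma exhaustion_tail (Dj : nat -> set RV) : subdomain_exhaustion D Dj ->
  exists eps : nat -> R, [/\ forall j, (0 < eps j)%R, eps @ \oo --> (0%R : R) &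
    forall j u, negative_subharmonic_on D u ->
      weighted_norm (D `\` Dj j) phi u <= (eps j)%:E * weighted_norm D phi u].
Proof.
move=> exD; have [domDj _ _] := exD.
have mD : measurable D by exact: open_measurable_rV.
have mDj j : measurable (D `\` Dj j).
  by apply: measurableD => //; apply: open_measurable_rV; have [[]] := domDj j.
have norm_ge0 u : 0 <= weighted_norm D phi u.
  by apply: integral_ge0 => x Dx; rewrite mule_ge0// lee_fin ltW// weight_sum_gt0.
(* Quantifying over [u] inside the predicate makes [eps] independent of [u]. *)
apply: (@exists_vanishing_sequence _ (fun j e => forall u, negative_subharmonic_on D u ->
      weighted_norm (D `\` Dj j) phi u <= e%:E * weighted_norm D phi u)).
- by move=> j u nu; rewrite mul1e; apply: le_weighted_norm.
- move=> j e e' ee' Qe u nu; apply: le_trans (Qe u nu) _.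
  by rewrite lee_wpmul2r.
move=> e e0; have [K K0 mK] := mass_le_weighted_norm.
have [N Ne] := exists_half_exp_le (divr_gt0 e0 K0).
(* By induction on [N], the finitely many compact sets carrying the first [N] bumps eventually lie
   in [Dj j]. *)
have near_supp : \forall j \near \oo, forall k, (k < N)%N ->
    forall x, (D `\` Dj j) x -> psi k x = 0%R.
  elim: N {Ne} => [|N IH]; first by near=> j.
  have [_ _ [Ks cKs [KsD Ks0]] _] := psi_bump N.
  have KsDj := exhaustion_covers_compact exD cKs KsD.
  near=> j; move=> k; rewrite ltnS leq_eqVlt => /predU1P[-> x [_ nDjx]|].
    by apply: Ks0 => Ksx; apply: nDjx; move: x Ksx; near: j.
  by move: k; near: j.
near=> j; move=> u nu.
apply: (@le_trans _ _ (((2 ^+ N)^-1)%:E * m u)).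
  by apply: weighted_norm_tail => //; near: j.
apply: (@le_trans _ _ ((e / K)%:E * (K%:E * weighted_norm D phi u))).
  apply: lee_pmul => //.
  exact: mK.
by rewrite muleA -EFinM divfK// gt_eqF.
Unshelve. all: by end_near. Qed.

Lemma norming_weight_sum : norming D phi.
Proof.
split; [exact: weight_sum_gt0|exact: continuous_subspaceT|].
(* Stated for every [F], with the dummy value 0 outside the compact subsets of [D], so that [choice]
   yields a function [C] fixed before [u]; likewise for [eps] below. *)
have compact_bound F : exists C : R, compact F -> F `<=` D -> (0 < C)%R /\
    forall u, negative_subharmonic_on D u -> forall x, F x ->
      u x <= - (C%:E * weighted_norm D phi u).
  have [[cF FD]|nF] := pselect (compact F /\ F `<=` D); last first.
    by exists 0%R => cF FD; exfalso; exact: nF.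
  have [C C0 FC] := compact_harnack (fun y Fy => DH (FD y Fy)) cF.
  exists (C^-1)%R => _ _; split=> [|u nu x Fx]; first by rewrite invr_gt0.
  have [_ u0 _] := nu.
  rewrite leeNr -lee0_abs ?u0//; last exact: FD.
  rewrite lee_pdivrMl//; apply: le_trans (FC u nu x Fx).
  exact: weighted_norm_le_mass.
have [C CP] := choice compact_bound.
have tails Dj : exists eps : nat -> R, subdomain_exhaustion D Dj ->
    [/\ forall j, (0 < eps j)%R, eps @ \oo --> (0%R : R) &
    forall j u, negative_subharmonic_on D u ->
      weighted_norm (D `\` Dj j) phi u <= (eps j)%:E * weighted_norm D phi u].
  have [/exhaustion_tail[eps epsP]|nD] := pselect (subdomain_exhaustion D Dj).
    by exists eps.
  by exists (fun=> 0%R) => /nD.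
have [eps epsP] := choice tails.
exists C, eps; split.
- by move=> F cF FD; have [] := CP F cF FD.
- by move=> Dj /epsP[].
- move=> u nu; split.
  + by apply: le_lt_trans (weighted_norm_le_mass nu) (mass_lty nu).
  + by move=> F cF FD; have [_] := CP F cF FD; apply.
  + by move=> Dj /epsP[_ _ +] j; apply.
Qed.

End weighted_norm_bounds.

Theorem theorem4p3 (R : realType) (n : nat) (hn : (0 < n)%N)
    (D : set 'rV[R]_n) (hD : domain D) :
  exists phi : 'rV[R]_n -> R, norming D phi.
Proof.
have [m m_ge0 DH] := domain_harnack_comparable hD.
have [_ oD _] := hD.
have [psi [psi_bump psi_gt0]] := exists_bump_family m_ge0 oD DH.
by exists (weight_sum psi); exact: norming_weight_sum DH psi_bump psi_gt0.
Qed.
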